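(* For any two non-empty finite sets of primes $P_1$ and $P_2$, there exists a network $\mathcal{N}$ such that $P(\mathcal{N},2)=P_1\cup P_2$ and $P(\mathcal{N},3)=P_2$.
   Context: A network is a finite directed acyclic multigraph whose nodes are partitioned into sources (no incoming edges), terminals (no outgoing edges) and intermediate nodes; each terminal demands the messages of a specified set of sources. For a positive integer $d$ and a finite field $F$, a $d$-dimensional vector linear network code (VLNC) over $F$ works as follows: each source $s$ generates a message $x_s\in F^d$ (messages of different sources are independent and arbitrary); each edge $e$ carries a vector $y_e\in F^d$, where $y_e=Ax_s$ for some $d\times d$ matrix $A$ over $F$ if the tail of $e$ is a source $s$, and $y_e=\sum_{e'} A_{e',e}y_{e'}$ (sum over edges $e'$ entering the tail of $e$, with $d\times d$ matrices $A_{e',e}$ over $F$) if the tail of $e$ is an intermediate node; each terminal $t$ computes vectors of the form $\sum_{e} B_e y_e$ (sum over edges $e$ entering $t$, with fixed $d\times d$ matrices $B_e$). The code is a $d$-dimensional VLNC solution over $F$ if for all choices of source messages every terminal computes each of its demanded messages. For a network $\mathcal{N}$, a positive integer $d$ and a set $S$ of primes, we write $P(\mathcal{N},d)=S$ to mean: for every finite field $F$, $\mathcal{N}$ has a $d$-dimensional VLNC solution over $F$ if and only if the characteristic of $F$ belongs to $S$. *)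

(* Defs.v *)
From HB Require Import structures.
From mathcomp Require Import all_boot all_order all_algebra.
Set Implicit Arguments. Unset Strict Implicit. Unset Printing Implicit Defensive.
Import GRing.Theory.
Local Open Scope ring_scope.

Record network := Network {
  nv : nat;
  ne : nat;
  tl : 'I_ne -> 'I_nv;
  hd : 'I_ne -> 'I_nv;
  is_src : pred 'I_nv;
  is_term : pred 'I_nv;
  demand : 'I_nv -> {set 'I_nv}
}.
Arguments tl : clear implicits.
Arguments hd : clear implicits.
Arguments is_src : clear implicits.
Arguments is_term : clear implicits.
Arguments demand : clear implicits.

Definition well_formed (N : network) : Prop :=
  [/\ (forall v, ~~ (is_src N v && is_term N v)),
      (forall e, ~~ is_src N (hd N e)),
      (forall e, ~~ is_term N (tl N e)),
      (forall t s, s \in demand N t -> is_term N t && is_src N s) &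
      (exists r : 'I_(nv N) -> nat, forall e, (r (tl N e) < r (hd N e))%N)].

(* N has a d-dimensional vector linear network code solution over F.
   As e : local coding matrix of an edge leaving a source;
   Ai e' e : local coding matrix from edge e' into the tail of e (intermediate);
   B t s e : decoding matrix used by terminal t, for demanded source s,
   applied to incoming edge e.  Since the network is acyclic, the edge
   vectors y are uniquely determined by the messages x, so quantifying over
   all y satisfying the coding equations is the same as using the induced y. *)
Definition vlnc_solution (N : network) (d : nat) (F : fieldType) : Prop :=
  exists (As : 'I_(ne N) -> 'M[F]_d)
         (Ai : 'I_(ne N) -> 'I_(ne N) -> 'M[F]_d)
         (B : 'I_(nv N) -> 'I_(nv N) -> 'I_(ne N) -> 'M[F]_d),
  forall (x : 'I_(nv N) -> 'cV[F]_d) (y : 'I_(ne N) -> 'cV[F]_d),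
    (forall e, is_src N (tl N e) -> y e = As e *m x (tl N e)) ->
    (forall e, ~~ is_src N (tl N e) ->
        y e = \sum_(e' | hd N e' == tl N e) Ai e' e *m y e') ->
    forall t s, is_term N t -> s \in demand N t ->
      \sum_(e | hd N e == t) B t s e *m y e = x s.

Definition P_eq (N : network) (d : nat) (S : seq nat) : Prop :=
  forall F : finFieldType,
    vlnc_solution N d F <-> exists2 p : nat, p \in [pchar F] & p \in S.

(* Main.v *)
(* Let [m] be the product of [P2] and [q] that of [P1 ++ P2].  The network is
   solvable in dimension d over F iff [q = 0] in F and there is a d x d matrix
   X with [X ^ 2 = 0] such that, unless [m = 0] in F, two vectors b and g can be
   recovered from [X b], [X g] and one further d-dimensional linear function of
   (b, g).  The latter needs [2 \rank X >= d] while [X ^ 2 = 0] gives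
   [2 \rank X <= d]: so d is even unless [m = 0], and for d = 2 a nilpotent
   Jordan block works over every field.

   All networks used are layered: sources, then bottleneck edges ("forms"), then
   terminals.  A terminal can decode a source iff the source vanishes on the
   common kernel of all the terminal receives, so only kernels matter.  Once a
   form S of all sources is available, a terminal that demands a source [s] from
   S, a form f not involving [s], and all sources other than [s] not occurring
   in f forces f to have the same kernel as the part of S on the inputs of f;
   after rescaling the sources, f is then their plain sum. *)

Require Import Defs.
From HB Require Import structures.
From mathcomp Require Import all_boot all_order all_algebra finfield.
Set Implicit Arguments. Unset Strict Implicit. Unset Printing Implicit Defensive.
Import GRing.Theory.
Local Open Scope ring_scope.

(** * Factoring a coordinate through linear measurements *)

Section LinearFactor.
Variables (F : fieldType) (d : nat) (I J : finType).
Local Notation VI := {ffun I -> 'cV[F]_d}.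
Local Notation VJ := {ffun J -> 'cV[F]_d}.
Variable C : J -> I -> 'M[F]_d.

Definition block_map (x : VI) : VJ := [ffun j => \sum_i C j i *m x i].

Fact block_map_linear : linear block_map.
Proof.
move=> a x y; apply/ffunP=> j; rewrite !ffunE scaler_sumr -big_split /=.
by apply: eq_bigr => i _; rewrite !ffunE mulmxDr scalemxAr.
Qed.
HB.instance Definition _ :=
  GRing.isLinear.Build F VI VJ *:%R block_map block_map_linear.

Definition ffun_single (j : J) (v : 'cV[F]_d) : VJ :=
  [ffun j' => if j' == j then v else 0].

Fact ffun_single_linear j : linear (ffun_single j).
Proof.
move=> a x y; apply/ffunP=> j'; rewrite !ffunE.
by case: eqP => // _; rewrite scaler0 addr0.
Qed.
HB.instance Definition _ j :=
  GRing.isLinear.Build F 'cV[F]_d VJ *:%R (ffun_single j) (ffun_single_linear j).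

Definition ffun_eval (s : I) (x : VI) : 'cV[F]_d := x s.
Fact ffun_eval_linear s : linear (ffun_eval s).
Proof. by move=> a x y; rewrite /ffun_eval !ffunE. Qed.
HB.instance Definition _ s :=
  GRing.isLinear.Build F VI 'cV[F]_d *:%R (ffun_eval s) (ffun_eval_linear s).

Lemma colmx_linearP (f : {linear 'cV[F]_d -> 'cV[F]_d}) :
  exists B : 'M[F]_d, forall v, B *m v = f v.
Proof.
exists (\matrix_(a, b) (f (delta_mx b 0)) a 0) => v.
rewrite {2}(matrix_sum_delta v) linear_sum; apply/colP=> a.
rewrite !mxE summxE; apply: eq_bigr => b _.
by rewrite big_ord1 linearZ !mxE mulrC.
Qed.

(** The coordinate at [s] vanishes on the kernel of the block map [A], so it factors through the
    image of [A]. Composing it with a partial inverse of [A] gives the factor, whose restrictions to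
    the summands are the matrices [B j]. *)
Lemma linear_factor (s : I) :
  (forall x : I -> 'cV[F]_d,
     (forall j, \sum_i C j i *m x i = 0) -> x s = 0) ->
  exists B : J -> 'M[F]_d, forall x : I -> 'cV[F]_d,
    \sum_j B j *m (\sum_i C j i *m x i) = x s.
Proof.
move=> ker_s; pose A := linfun block_map.
pose K := (linfun (ffun_eval s) \o A^-1)%VF.
have KA (x : VI) : K (A x) = x s.
  rewrite comp_lfunE [LHS]lfunE -[RHS]/(ffun_eval s x).
  apply/eqP; rewrite -subr_eq0 -linearB; apply/eqP; apply: ker_s => j.
  (* [A^-1 (A x)] and [x] have the same image under [A], so their difference lies in the kernel. *)
  set y := (X in fun_of_fin X).
  have: A y = 0.
    by rewrite linearB /= limg_lfunVK ?subrr // memv_img ?memvf.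
  by move=> /ffunP/(_ j); rewrite lfunE !ffunE.
have /fin_all_exists[B HB] (j : J) :
    exists B : 'M[F]_d, forall v, B *m v = K (ffun_single j v).
  exact: (colmx_linearP (K \o ffun_single j)).
exists B => x; rewrite -[RHS](ffunE (fun i : I => x i)) -KA.
have -> : A (finfun x) = \sum_j ffun_single j (\sum_i C j i *m x i).
  apply/ffunP=> j; rewrite lfunE sum_ffunE (bigD1 j) //=.
  rewrite [block_map _ j]ffunE [ffun_single j _ j]ffunE eqxx [X in _ + X]big1.
    by rewrite addr0; apply: eq_bigr => i _; rewrite ffunE.
  by move=> i /negPf ij; rewrite [LHS]ffunE eq_sym ij.
by rewrite linear_sum; apply: eq_bigr => j _; rewrite HB.
Qed.
End LinearFactor.

(** * Networks on arbitrary finite types *)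

Section GraphNetwork.
Variables (V E : finType) (tlg hdg : E -> V) (src ter : pred V).
Variable (dem : V -> pred V).

(** The record [network] asks for ordinals as nodes and edges; [enum_rank] and [enum_val] carry the
    graph over to them. *)
Definition graph_net : network :=
  @Network #|V| #|E| (fun e => enum_rank (tlg (enum_val e)))
    (fun e => enum_rank (hdg (enum_val e))) (fun v => src (enum_val v))
    (fun v => ter (enum_val v))
    (fun v => [set u | dem (enum_val v) (enum_val u)]).

Lemma sum_graph_net (W : nmodType) (u : V) (f : 'I_#|E| -> W) :
  \sum_(e | hd graph_net e == enum_rank u) f e
    = \sum_(e | hdg e == u) f (enum_rank e).
Proof.
rewrite (reindex _ (onW_bij _ (@enum_rank_bij E))) /=.
by apply: eq_bigl => e; rewrite enum_rankK (inj_eq enum_rank_inj).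
Qed.

Definition graph_solution (d : nat) (F : fieldType) : Prop :=
  exists (As : E -> 'M[F]_d) (Ai : E -> E -> 'M[F]_d) (B : V -> V -> E -> 'M[F]_d),
  forall (x : V -> 'cV[F]_d) (y : E -> 'cV[F]_d),
    (forall e, src (tlg e) -> y e = As e *m x (tlg e)) ->
    (forall e, ~~ src (tlg e) ->
        y e = \sum_(e' | hdg e' == tlg e) Ai e' e *m y e') ->
    forall t s, ter t -> dem t s -> \sum_(e | hdg e == t) B t s e *m y e = x s.

Lemma graph_netP d F : vlnc_solution graph_net d F <-> graph_solution d F.
Proof.
split=> [] [As [Ai [B H]]].
  exists (fun e => As (enum_rank e)), (fun e e' => Ai (enum_rank e) (enum_rank e')).
  exists (fun u v e => B (enum_rank u) (enum_rank v) (enum_rank e)) => x y Hs Hi t s Ht Hd.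
  have := H (x \o enum_val) (y \o enum_val) _ _ (enum_rank t) (enum_rank s).
  rewrite sum_graph_net /= inE !enum_rankK.
  under eq_bigr do rewrite enum_rankK.
  move=> H'; apply: H' => // e; rewrite enum_rankK => se.
    by rewrite Hs // enum_valK.
  rewrite Hi // -[RHS]/(\sum_(e' | hd graph_net e' == enum_rank (tlg (enum_val e)))
                          Ai e' e *m y (enum_val e')).
  by rewrite sum_graph_net; apply: eq_bigr => e' _; rewrite enum_rankK enum_valK.
exists (As \o enum_val), (fun e e' => Ai (enum_val e) (enum_val e')).
exists (fun u v e => B (enum_val u) (enum_val v) (enum_val e)) => x y Hs Hi t s Ht.
rewrite inE => Hd; rewrite -[in X in X = _](enum_valK t) sum_graph_net enum_valK.
under eq_bigr do rewrite enum_rankK.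
rewrite (H (x \o enum_rank) (y \o enum_rank)) //= ?enum_valK // => e se.
  by rewrite Hs /= !enum_rankK.
rewrite Hi /= ?enum_rankK // sum_graph_net.
by apply: eq_bigr => e' _; rewrite enum_rankK.
Qed.

End GraphNetwork.

(** * Layered networks and their kernel criterion *)

Section LayeredNetwork.
Variables (S R T : finType).
Variables (inp : R -> pred S) (accs : T -> pred S) (accr : T -> pred R).
Variable (demands : T -> pred S).

(* [None] is a node without incoming edges: edges leaving it carry zero, so
   it serves as the tail of the edges that should be absent. *)
Definition lnode : finType := option ((S + T) + (R + R))%type.
(** In order: source to form, the bottleneck of a form, form to terminal, source to terminal. The
    single edge from [in_node r] to [out_node r] limits a form to one d-dimensional vector. *)
Definition ledge : finType := (((S * R) + R) + ((R * T) + (S * T)))%type.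
Definition src_node (s : S) : lnode := Some (inl (inl s)).
Definition ter_node (t : T) : lnode := Some (inl (inr t)).
Definition in_node (r : R) : lnode := Some (inr (inl r)).
Definition out_node (r : R) : lnode := Some (inr (inr r)).

Definition ltail (e : ledge) : lnode :=
  match e with
  | inl (inl (s, r)) => if inp r s then src_node s else None
  | inl (inr r) => in_node r
  | inr (inl (r, t)) => if accr t r then out_node r else None
  | inr (inr (s, t)) => if accs t s then src_node s else None
  end.

Definition lhead (e : ledge) : lnode :=
  match e with
  | inl (inl (_, r)) => in_node r
  | inl (inr r) => out_node r
  | inr (inl (_, t)) | inr (inr (_, t)) => ter_node t
  end.

Definition lsrc (v : lnode) : bool := if v is Some (inl (inl _)) then true else false.
Definition lter (v : lnode) : bool := if v is Some (inl (inr _)) then true else false.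
Definition ldem (t s : lnode) : bool :=
  match t, s with
  | Some (inl (inr t)), Some (inl (inl s)) => demands t s
  | _, _ => false
  end.

Definition layered_net : network := graph_net ltail lhead lsrc lter ldem.

Lemma layered_net_wf : well_formed layered_net.
Proof.
split=> /=.
- by move=> v; case: (enum_val v) => [[[]|]|].
- by move=> e; rewrite enum_rankK; case: (enum_val e) => [[[]|]|[[]|[]]].
- move=> e; rewrite enum_rankK; case: (enum_val e) => [[[s r]|r]|[[r t]|[s t]]] //=.
  + by case: ifP.
  + by case: ifP.
  + by case: ifP.
- move=> t s; rewrite inE.
  by case: (enum_val t) => [[[]|]|] //; case: (enum_val s) => [[[]|]|].
pose rk (v : lnode) : nat := match v with
  | Some (inr (inl _)) => 1 | Some (inr (inr _)) => 2
  | Some (inl (inr _)) => 3 | _ => 0 end.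
exists (fun v => rk (enum_val v)) => e; rewrite !enum_rankK.
by case: (enum_val e) => [[[s r]|r]|[[r t]|[s t]]] //=; case: ifP.
Qed.

Section Sums.
Variables (W : nmodType) (f : ledge -> W).
Local Notation hsum v := (\sum_(e | lhead e == v) f e).

Lemma sum_pairr (A B : finType) (b : B) (P : pred (A * B)) (g : A * B -> W) :
  (forall p, P p = (p.2 == b)) -> \sum_(p | P p) g p = \sum_a g (a, b).
Proof.
move=> HP; rewrite (eq_bigl (fun p => p.2 == b)) //.
rewrite (reindex_onto (fun a => (a, b)) fst) /=.
  by apply: eq_bigl => a; rewrite !eqxx.
by move=> [a b'] /= /eqP->.
Qed.

Lemma lsum_in r : hsum (in_node r) = \sum_s f (inl (inl (s, r))).
Proof.
rewrite !big_sumType /= (sum_pairr (b := r)); last by case.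
rewrite -addrA -[RHS]addr0; congr (_ + _).
by rewrite !big_pred0 ?addr0 //; case.
Qed.

Lemma lsum_out r : hsum (out_node r) = f (inl (inr r)).
Proof.
rewrite !big_sumType /= -[RHS]addr0; congr (_ + _).
  by rewrite (big_pred1 r) // big_pred0 ?add0r //; case.
by rewrite !big_pred0 ?addr0 //; case.
Qed.

Lemma lsum_ter t : hsum (ter_node t) =
  \sum_r f (inr (inl (r, t))) + \sum_s f (inr (inr (s, t))).
Proof.
rewrite !big_sumType /= !(sum_pairr (b := t)); try by case.
rewrite -[RHS]add0r; congr (_ + _).
by rewrite !big_pred0 ?add0r //; case.
Qed.

Lemma lsum_none : hsum None = 0.
Proof. by rewrite big_pred0 // => -[[[]|]|[[]|[]]]. Qed.
End Sums.

(** Decoding matrices are eliminated: they exist exactly when the demanded message vanishes whenever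
    all that the terminal receives does. [G r j] is the total coefficient of source [j] in form
    [r]. *)
Definition layered_solution (d : nat) (F : fieldType) : Prop :=
  exists G : R -> S -> 'M[F]_d, forall t s, demands t s ->
  forall x : S -> 'cV[F]_d,
    (forall j, accs t j -> x j = 0) ->
    (forall r, accr t r -> \sum_(j | inp r j) G r j *m x j = 0) ->
    x s = 0.

Lemma layered_solution_necessary d F :
  vlnc_solution layered_net d F -> layered_solution d F.
Proof.
case/graph_netP=> As [Ai [B H]].
exists (fun r s => Ai (inl (inl (s, r))) (inl (inr r)) *m As (inl (inl (s, r)))).
move=> t s ts x xs0 xr0.
pose x' (v : lnode) := if v is Some (inl (inl j)) then x j else 0.
pose yr r := \sum_(j | inp r j) Ai (inl (inl (j, r))) (inl (inr r))
                               *m (As (inl (inl (j, r))) *m x j).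
(* The edge vectors induced by [x]. All those entering [t] are zero, so decoding them gives both
   [x s] and 0. *)
pose y (e : ledge) : 'cV[F]_d := match e with
  | inl (inl (j, r)) => if inp r j then As e *m x j else 0
  | inl (inr r) => yr r
  | inr (inl (r, t)) => if accr t r then Ai (inl (inr r)) e *m yr r else 0
  | inr (inr (j, t)) => if accs t j then As e *m x j else 0
  end.
have ys e : lsrc (ltail e) -> y e = As e *m x' (ltail e).
  by case: e => [[[j r]|r]|[[r t']|[j t']]] //=; case: ifP.
have yi e : ~~ lsrc (ltail e) ->
    y e = \sum_(e' | lhead e' == ltail e) Ai e' e *m y e'.
  case: e => [[[j r]|r]|[[r t']|[j t']]] /=; try case: ifP => //= _ _.
  - by rewrite lsum_none.
  - rewrite lsum_in /yr big_mkcond; move=> _; apply: eq_bigr => j _ /=.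
    by case: ifP; rewrite ?mulmx0.
  - by rewrite lsum_out.
  - by rewrite lsum_none.
  - by rewrite lsum_none.
rewrite -[LHS](H x' y ys yi (ter_node t) (src_node s) isT ts) lsum_ter.
rewrite !big1 ?addr0 // => [j|r] _ /=; case: ifP => [tr|_]; rewrite ?mulmx0 //.
- by rewrite xs0 // !mulmx0.
- suff -> : yr r = 0 by rewrite !mulmx0.
  by rewrite -[RHS](xr0 r tr); apply: eq_bigr => j _; rewrite mulmxA.
Qed.

Lemma layered_solution_sufficient d F :
  layered_solution d F -> vlnc_solution layered_net d F.
Proof.
case=> G H; apply/graph_netP.
(* [C t] lists what [t] receives, first the forms and then the sources, with zero blocks for what it
   cannot access. *)
pose C t (k : R + S) (j : S) : 'M[F]_d := match k with
  | inl r => if accr t r && inp r j then G r j else 0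
  | inr i => if accs t i && (i == j) then 1%:M else 0
  end.
have /fin_all_exists[B HB] (t : T) : exists B : S -> R + S -> 'M[F]_d,
    forall s, demands t s -> forall x : S -> 'cV[F]_d,
    \sum_k B s k *m (\sum_j C t k j *m x j) = x s.
  suff /fin_all_exists[B HB] s : exists B : R + S -> 'M[F]_d, demands t s ->
      forall x : S -> 'cV[F]_d, \sum_k B k *m (\sum_j C t k j *m x j) = x s.
    by exists B.
  case: (boolP (demands t s)) => ts; last by exists (fun=> 0).
  suff [B HB] : exists B : R + S -> 'M[F]_d, forall x : S -> 'cV[F]_d,
      \sum_k B k *m (\sum_j C t k j *m x j) = x s by exists B.
  apply: linear_factor => x x0; apply: (H t s ts).
    move=> i ti; rewrite -[RHS](x0 (inr i)) (bigD1 i) //= ti eqxx mul1mx.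
    rewrite big1 ?addr0 // => j ji.
    by rewrite eq_sym (negPf ji) mul0mx.
  move=> r tr; rewrite -[RHS](x0 (inl r)) /= tr big_mkcond; apply: eq_bigr => j _.
  by case: ifP; rewrite ?mul0mx.
(* Sources send their messages unchanged, the bottleneck edge applies [G], and the edges after it
   only relay. *)
pose Ai (e' e : ledge) : 'M[F]_d := match e', e with
  | inl (inl (j, r)), inl (inr _) => G r j
  | inl (inr _), inr (inl _) => 1%:M
  | _, _ => 0
  end.
pose B' (v u : lnode) (e : ledge) : 'M[F]_d := match v, u, e with
  | Some (inl (inr t)), Some (inl (inl s)), inr (inl (r, _)) => B t s (inl r)
  | Some (inl (inr t)), Some (inl (inl s)), inr (inr (j, _)) => B t s (inr j)
  | _, _, _ => 0
  end.
exists (fun=> 1%:M), Ai, B' => x y ys yi.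
case=> [[[s'|t]|r]|] // [[[s|t']|r]|] // _ /= ts.
rewrite -(HB t s ts (fun j => x (src_node j))) lsum_ter big_sumType /=.
have y_in r j : y (inl (inl (j, r))) = if inp r j then x (src_node j) else 0.
  case: (boolP (inp r j)) => rj; first by rewrite ys /= rj ?mul1mx.
  by rewrite yi /= (negPf rj) // lsum_none.
have y_mid r : y (inl (inr r)) = \sum_(j | inp r j) G r j *m x (src_node j).
  rewrite yi // lsum_in [RHS]big_mkcond; apply: eq_bigr => j _ /=.
  by rewrite y_in; case: ifP; rewrite ?mulmx0.
congr (_ + _); apply: eq_bigr => k _; congr (_ *m _).
  case: (boolP (accr t k)) => tk.
    rewrite yi /= tk // lsum_out /= mul1mx y_mid big_mkcond; apply: eq_bigr => j _.
    by case: ifP; rewrite ?mul0mx.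
  rewrite yi /= (negPf tk) // lsum_none big1 // => j _.
  by rewrite mul0mx.
case: (boolP (accs t k)) => tk.
  rewrite ys /= tk // mul1mx (bigD1 k) //= eqxx mul1mx big1 ?addr0 // => j jk.
  by rewrite eq_sym (negPf jk) mul0mx.
rewrite yi /= (negPf tk) // lsum_none big1 // => j _.
by rewrite mul0mx.
Qed.

Lemma layered_netP d F : vlnc_solution layered_net d F <-> layered_solution d F.
Proof.
by split; [exact: layered_solution_necessary|exact: layered_solution_sufficient].
Qed.
End LayeredNetwork.

(** * Matrices tested on column vectors *)

Lemma unitmx_inj_col (F : fieldType) d (A : 'M[F]_d) :
  (forall v : 'cV[F]_d, A *m v = 0 -> v = 0) -> A \in unitmx.
Proof.
move=> injA; rewrite -unitmx_tr -row_free_unit -kermx_eq0.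
apply/rowV0P => u /sub_kermxP uA; apply: trmx_inj; rewrite trmx0; apply: injA.
by rewrite -[A]trmxK -trmx_mul uA trmx0.
Qed.

Lemma mulmx_col_eq0 (F : fieldType) m d (A : 'M[F]_(m, d)) :
  (forall v : 'cV[F]_d, A *m v = 0) -> A = 0.
Proof.
move=> A0; apply/matrixP=> i j; rewrite mxE.
by have /matrixP/(_ i 0) := A0 (delta_mx j 0); rewrite -colE !mxE.
Qed.

(* After rescaling the sources, the forms are, writing b, g, c, c', e, z_i for
   [Beta], [Gamma], [Cb], [Cg], [Delta], [Z i]:
     U i = z_i + e           VM = b + \sum_(i < m) z_i    VQ = b + \sum_(i < q) z_i
     BC = b + c'             BG = b + g                   CCD = c + c' + e
     Eb = c + X b            Eg = c' + Y g                Eh = H1 b + H2 g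
   for arbitrary matrices X, Y, H1, H2.  Demanding b from U and VQ yields
   [q = 0] in F; c from Eb, BC, Eg yields [X Y = 0]; e from Eb, Eg, BG, CCD
   yields [X = Y].  In [TA], the forms U and VM only give [m e = b], which
   discloses b exactly when [m = 0]. *)
Inductive source (q : nat) := Beta | Gamma | Cb | Cg | Delta | Z of 'I_q.
Arguments Beta {q}. Arguments Gamma {q}. Arguments Cb {q}.
Arguments Cg {q}. Arguments Delta {q}.

Inductive form (q : nat) :=
  All | U of 'I_q | VM | VQ | BC | BG | CCD | Eb | Eg | Eh.
Arguments All {q}. Arguments VM {q}. Arguments VQ {q}. Arguments BC {q}.
Arguments BG {q}. Arguments CCD {q}.
Arguments Eb {q}. Arguments Eg {q}. Arguments Eh {q}.

(** [Tforce f s] exists for every pair, which keeps the type finite by a plain product; [dem] gives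
    it a demand only if [f] is forced and does not involve [s]. *)
Inductive terminal (q : nat) :=
  Tforce of form q & source q | TEb | TEg | TQ | TX | TE | TA.
Arguments TEb {q}. Arguments TEg {q}. Arguments TQ {q}. Arguments TX {q}.
Arguments TE {q}. Arguments TA {q}.

(** * Finiteness of the types of sources, forms and terminals *)

Definition source_code q (s : source q) : 'I_5 + 'I_q :=
  match s with
  | Beta => inl (@Ordinal 5 0 isT)
  | Gamma => inl (@Ordinal 5 1 isT)
  | Cb => inl (@Ordinal 5 2 isT)
  | Cg => inl (@Ordinal 5 3 isT)
  | Delta => inl (@Ordinal 5 4 isT)
  | Z i => inr i
  end.
Definition source_decode q (c : 'I_5 + 'I_q) : source q :=
  match c with
  | inr i => Z i
  | inl k => nth Beta [:: Beta; Gamma; Cb; Cg; Delta] k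
  end.
Lemma source_codeK q : cancel (@source_code q) (@source_decode q).
Proof. by case. Qed.
HB.instance Definition _ q := Finite.copy (source q) (can_type (@source_codeK q)).

Definition form_code q (f : form q) : 'I_9 + 'I_q :=
  match f with
  | All => inl (@Ordinal 9 0 isT)
  | VM => inl (@Ordinal 9 1 isT)
  | VQ => inl (@Ordinal 9 2 isT)
  | BC => inl (@Ordinal 9 3 isT)
  | BG => inl (@Ordinal 9 4 isT)
  | CCD => inl (@Ordinal 9 5 isT)
  | Eb => inl (@Ordinal 9 6 isT)
  | Eg => inl (@Ordinal 9 7 isT)
  | Eh => inl (@Ordinal 9 8 isT)
  | U i => inr i
  end.
Definition form_decode q (c : 'I_9 + 'I_q) : form q :=
  match c with
  | inr i => U i
  | inl k => nth All [:: All; VM; VQ; BC; BG; CCD; Eb; Eg; Eh] k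
  end.
Lemma form_codeK q : cancel (@form_code q) (@form_decode q).
Proof. by case. Qed.
HB.instance Definition _ q := Finite.copy (form q) (can_type (@form_codeK q)).

Definition terminal_code q (t : terminal q) : 'I_6 + form q * source q :=
  match t with
  | TEb => inl (@Ordinal 6 0 isT)
  | TEg => inl (@Ordinal 6 1 isT)
  | TQ => inl (@Ordinal 6 2 isT)
  | TX => inl (@Ordinal 6 3 isT)
  | TE => inl (@Ordinal 6 4 isT)
  | TA => inl (@Ordinal 6 5 isT)
  | Tforce f s => inr (f, s)
  end.
Definition terminal_decode q (c : 'I_6 + form q * source q) : terminal q :=
  match c with
  | inr (f, s) => Tforce f s
  | inl k => nth TEb [:: TEb; TEg; TQ; TX; TE; TA] k
  end.
Lemma terminal_codeK q : cancel (@terminal_code q) (@terminal_decode q).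
Proof. by case. Qed.
HB.instance Definition _ q :=
  Finite.copy (terminal q) (can_type (@terminal_codeK q)).

Lemma big_source (V : nmodType) q (P : pred (source q)) (E : source q -> V) :
  \sum_(s | P s) E s =
    (if P Beta then E Beta else 0) + (if P Gamma then E Gamma else 0)
    + (if P Cb then E Cb else 0) + (if P Cg then E Cg else 0)
    + (if P Delta then E Delta else 0) + \sum_(i | P (Z i)) E (Z i).
Proof.
have dcK : cancel (@source_decode q) (@source_code q).
  case=> //= k; case: k => [[|[|[|[|[|//]]]]] lt_k] /=;
  by congr inl; apply: val_inj.
rewrite big_mkcond (reindex (@source_decode q)) /=; last first.
  by exists (@source_code q) => ? _; [apply: dcK | apply: source_codeK].
rewrite big_sumType /= !big_ord_recl big_ord0 /= addr0 -big_mkcond.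
by rewrite !addrA.
Qed.

(** * The gadget: incidences and demands *)

Section Gadget.
Variables (m q : nat).
Hypothesis le_mq : (m <= q)%N.
Local Notation source := (source q).
Local Notation form := (form q).
Local Notation terminal := (terminal q).

Definition inp (f : form) (s : source) : bool :=
  match f, s with
  | All, _ => true
  | U i, Z j => j == i
  | U _, Delta => true
  | VM, Z j => (j < m)%N
  | VQ, Z _ => true
  | (VM | VQ), Beta => true
  | BC, (Beta | Cg) => true
  | BG, (Beta | Gamma) => true
  | CCD, (Cb | Cg | Delta) => true
  | Eb, (Cb | Beta) => true
  | Eg, (Cg | Gamma) => true
  | Eh, (Beta | Gamma) => true
  | _, _ => false
  end.

(** The forms whose kernel is tied to that of [All]; [Eb], [Eg] and [Eh] keep matrices of their
    own. *)
Definition forced (f : form) : bool :=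
  match f with All | Eb | Eg | Eh => false | _ => true end.

Definition accs (t : terminal) (s : source) : bool :=
  match t, s with
  | Tforce f s0, _ => ~~ inp f s && (s != s0)
  | TEb, Beta | TEg, Gamma | TA, (Cb | Cg) => true
  | _, _ => false
  end.

Definition accr (t : terminal) (f : form) : bool :=
  match t, f with
  | Tforce _ _, All => true
  | Tforce f0 _, _ => f == f0
  | TEb, Eb | TEg, Eg => true
  | TQ, (U _ | VQ) => true
  | TX, (Eb | BC | Eg) => true
  | TE, (Eb | Eg | BG | CCD) => true
  | TA, (Eb | Eg | Eh | U _ | VM) => true
  | _, _ => false
  end.

Definition dem (t : terminal) (s : source) : bool :=
  match t, s with
  | Tforce f s0, _ => [&& s == s0, forced f & ~~ inp f s]
  | TEb, Cb | TEg, Cg | TQ, Beta | TX, Cb | TE, Delta | TA, (Beta | Gamma) => true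
  | _, _ => false
  end.

Definition outside (f : form) : source :=
  match f with U _ | CCD => Beta | BG => Cb | _ => Gamma end.
Definition inside (f : form) : source :=
  match f with U _ | CCD => Delta | _ => Beta end.

Lemma outsideP f : forced f -> ~~ inp f (outside f).
Proof. by case: f. Qed.
Lemma insideP f : forced f -> inp f (inside f).
Proof. by case: f. Qed.

Lemma accr_force f s r : accr (Tforce f s) r -> r = All \/ r = f.
Proof. by case: r => [|?||||||||] /= rf; [left | right; apply/eqP..]. Qed.

Variables (F : fieldType) (d : nat).

(** * Forced forms agree with [All] up to kernel *)

Section Necessity.
Variable G : form -> source -> 'M[F]_d.
Local Notation value f x := (\sum_(j | inp f j) G f j *m x j).
Hypothesis GP : forall t s, dem t s -> forall x : source -> 'cV[F]_d,
    (forall j, accs t j -> x j = 0) ->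
    (forall r, accr t r -> value r x = 0) -> x s = 0.

Let A (j : source) : 'M[F]_d := G All j.
Let single (j : source) (v : 'cV[F]_d) (i : source) : 'cV[F]_d :=
  if i == j then v else 0.

Lemma value_single f j v : value f (single j v) = if inp f j then G f j *m v else 0.
Proof.
rewrite big_mkcond (bigD1 j) //= /single eqxx big1 ?addr0 // => i /negPf ->.
by rewrite mulmx0 if_same.
Qed.

Lemma force f s (x : source -> 'cV[F]_d) : forced f -> ~~ inp f s ->
  (forall j, ~~ inp f j -> j != s -> x j = 0) ->
  value f x = 0 -> value All x = 0 -> x s = 0.
Proof.
move=> ff fs x0 fx0 ax0; apply: (GP (t := Tforce f s)).
- by rewrite /= eqxx ff fs.
- by move=> j /andP[]; apply: x0.
- by move=> r /accr_force[] ->.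
Qed.

(** A vector killed by [A j], placed at [j] alone, is invisible to [All] and to a forced form not
    involving [j]; the terminal that recovers [j] from these sees only zeros. *)
Lemma unit_all j : A j \in unitmx.
Proof.
apply: unitmx_inj_col => v Av0.
have [f [ff fj]] : exists f, forced f /\ ~~ inp f j.
  by case: j {Av0} => [||||| i]; [exists CCD | exists CCD | exists BG ..].
have -> : v = single j v j by rewrite /single eqxx.
apply: (force ff fj); rewrite ?value_single //; last by rewrite (negPf fj).
by move=> i _ /negPf ij; rewrite /single ij.
Qed.

(** Choose the message at a source outside [f] so that [All] vanishes too. Forcing makes that
    message zero, hence also the part of [All] on the inputs of [f]. *)
Lemma forced_ker f (x : source -> 'cV[F]_d) : forced f -> value f x = 0 ->
  \sum_(j | inp f j) A j *m x j = 0.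
Proof.
move=> ff fx0; set w := LHS; set s := outside f.
have fs : ~~ inp f s := outsideP ff.
pose x' j := if inp f j then x j else if j == s then - (invmx (A s) *m w) else 0.
have x's : x' s = - (invmx (A s) *m w) by rewrite /x' (negPf fs) eqxx.
have: x' s = 0.
  apply: (force ff fs).
  - by rewrite /x' => j /negPf -> /negPf ->.
  - by rewrite -[RHS]fx0; apply: eq_bigr => j fj; rewrite /x' fj.
  rewrite (bigID (inp f)) /= (eq_bigr (fun j => A j *m x j)) -/w; last first.
    by move=> j fj; rewrite /x' fj.
  rewrite (bigD1 s) //= x's mulmxN mulKVmx ?unit_all // big1 ?addr0 ?subrr //.
  by move=> j /andP[/negPf fj /negPf js]; rewrite /x' fj js mulmx0.
rewrite x's => /eqP; rewrite oppr_eq0 => /eqP aw0.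
by rewrite -(mulKVmx (unit_all s) w) aw0 mulmx0.
Qed.

(** By [forced_ker], the coefficient of [f] at an input [s] is injective, hence invertible.
    Correcting [x] at [s] puts it in the kernel of [f], and [forced_ker] then shows that the
    correction was zero. *)
Lemma forced_ker_converse f (x : source -> 'cV[F]_d) : forced f ->
  \sum_(j | inp f j) A j *m x j = 0 -> value f x = 0.
Proof.
move=> ff ax0; set w := LHS; set s := inside f.
have fs : inp f s := insideP ff.
have ker1 (v : 'cV[F]_d) : G f s *m v = 0 -> v = 0.
  move=> fv; have: \sum_(j | inp f j) A j *m single s v j = 0.
    by apply: forced_ker; rewrite // value_single fs.
  rewrite (bigD1 s) //= big1 => [|i /andP[_ /negPf ine]]; last first.
    by rewrite /single ine mulmx0.
  rewrite /single eqxx addr0 => /(congr1 (mulmx (invmx (A s)))).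
  by rewrite mulKmx ?unit_all ?mulmx0.
have ufs : G f s \in unitmx := unitmx_inj_col ker1.
pose u := invmx (G f s) *m w; pose x' j := x j - single s u j.
have x'0 : value f x' = 0.
  under eq_bigr do rewrite mulmxBr.
  by rewrite sumrB value_single fs mulKVmx // subrr.
move/(forced_ker ff): x'0; under eq_bigr do rewrite mulmxBr.
rewrite sumrB ax0 (bigD1 s) //= big1 => [|i /andP[_ /negPf ine]]; last first.
  by rewrite /single ine mulmx0.
rewrite /single eqxx addr0 sub0r => /eqP; rewrite oppr_eq0 => /eqP.
move=> /(congr1 (mulmx (invmx (A s)))); rewrite mulKmx ?unit_all // mulmx0.
by move=> u0; rewrite -(mulKVmx ufs w) -/u u0 mulmx0.
Qed.

(** In the coordinates [z j = A j *m x j], a form with inputs [c] and [b] and invertible coefficient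
    at [c] is, up to a left unit, [z c + X *m z b]. *)
Lemma free_value f c b (X := A c *m invmx (G f c) *m G f b *m invmx (A b))
    (z : source -> 'cV[F]_d) :
  G f c \in unitmx -> z c + X *m z b = 0 ->
  G f c *m (invmx (A c) *m z c) + G f b *m (invmx (A b) *m z b) = 0.
Proof.
move=> uc /eqP; rewrite addr_eq0 => /eqP ->.
rewrite /X !mulmxN -!mulmxA mulKmx ?unit_all // mulKVmx //.
by rewrite addNr.
Qed.

End Necessity.

(** * Normal form of a solution *)

Definition normal_value (X Y H1 H2 : 'M[F]_d) f (z : source -> 'cV[F]_d) :=
  match f with
  | Eb => z Cb + X *m z Beta
  | Eg => z Cg + Y *m z Gamma
  | Eh => H1 *m z Beta + H2 *m z Gamma
  | _ => \sum_(j | inp f j) z j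
  end.

Definition normal_solution (X Y H1 H2 : 'M[F]_d) :=
  forall t s, dem t s -> forall z : source -> 'cV[F]_d,
    (forall j, accs t j -> z j = 0) ->
    (forall r, accr t r -> normal_value X Y H1 H2 r z = 0) -> z s = 0.

(** The change of variables is [z j = A j *m x j]: forced forms get the kernel of a plain sum, and
    the matrices of the three free forms absorb the rescaling. *)
Lemma solution_normal :
  layered_solution inp accs accr dem d F ->
  exists X Y H1 H2, normal_solution X Y H1 H2.
Proof.
case=> G GP; pose A j := G All j; have uA := unit_all GP.
(* [TEb] recovers c from b and [Eb], so the coefficient of c is injective. [TEg] gives the same for
   c' in [Eg]. *)
have uEb : G Eb Cb \in unitmx.
  apply: unitmx_inj_col => v v0.
  have := GP TEb Cb isT (fun j => if j == Cb then v else 0); rewrite eqxx; apply.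
    by case.
  case=> // _; rewrite big_source /= v0 mulmx0 !(addr0, add0r).
  by rewrite big_pred0.
have uEg : G Eg Cg \in unitmx.
  apply: unitmx_inj_col => v v0.
  have := GP TEg Cg isT (fun j => if j == Cg then v else 0); rewrite eqxx; apply.
    by case.
  case=> // _; rewrite big_source /= v0 mulmx0 !(addr0, add0r).
  by rewrite big_pred0.
exists (A Cb *m invmx (G Eb Cb) *m G Eb Beta *m invmx (A Beta)).
exists (A Cg *m invmx (G Eg Cg) *m G Eg Gamma *m invmx (A Gamma)).
exists (G Eh Beta *m invmx (A Beta)), (G Eh Gamma *m invmx (A Gamma)).
move=> t s ts z zs zr.
suff zs0: invmx (A s) *m z s = 0.
  by rewrite -(mulKVmx (uA s) (z s)) zs0 mulmx0.
apply: (GP t s ts (fun j => invmx (A j) *m z j)).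
  by move=> j tj; rewrite zs ?mulmx0.
move=> r tr; have := zr r tr.
have forced_r : forced r -> \sum_(j | inp r j) z j = 0 ->
    \sum_(j | inp r j) G r j *m (invmx (A j) *m z j) = 0.
  move=> fr z0; apply: (forced_ker_converse GP fr); rewrite -[RHS]z0.
  by apply: eq_bigr => j _; rewrite mulKVmx ?uA.
case: r forced_r {tr} => [|i||||||||] forced_r; try exact: forced_r.
- move=> z0; rewrite -[RHS]z0; apply: eq_bigr => j _; exact: (mulKVmx (uA j)).
- move/(free_value GP uEb) => z0; rewrite big_source /= big_pred0 // !addr0.
  by rewrite addrC.
- move/(free_value GP uEg) => z0; rewrite big_source /= big_pred0 // !(addr0, add0r).
  by rewrite addrC.
- by rewrite /= -!mulmxA => z0; rewrite big_source /= big_pred0 // !addr0.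
Qed.

Lemma normal_solution_realizable X Y H1 H2 : normal_solution X Y H1 H2 ->
  layered_solution inp accs accr dem d F.
Proof.
move=> H; pose G (f : form) (j : source) : 'M[F]_d := match f, j with
  | Eb, Beta => X | Eg, Gamma => Y | Eh, Beta => H1 | Eh, Gamma => H2
  | _, _ => 1%:M end.
exists G => t s ts x xs xr; apply: (H t s ts x xs) => r tr.
rewrite -[RHS](xr r tr).
case: r {tr} => [|i||||||||] /=; try by apply: eq_bigr => j _; rewrite mul1mx.
all: rewrite big_source /= big_pred0 // ?mul1mx !(addr0, add0r) //.
all: by rewrite addrC.
Qed.

(** * Reduction to a condition on one nilpotent matrix *)

(** What [TA] must be able to decode. Its forms [U] and [VM] amount to [b = m e] with e free, which
    constrains b only if m is zero in the field. *)
Definition kernel_condition (X H1 H2 : 'M[F]_d) := forall b g : 'cV[F]_d,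
  (m%:R = 0 :> F -> b = 0) -> X *m b = 0 -> X *m g = 0 ->
  H1 *m b + H2 *m g = 0 -> b = 0 /\ g = 0.

(** Each conclusion comes from an assignment on which everything a suitable terminal receives
    vanishes, so that its demanded message must be zero. *)
Lemma normal_solution_necessary X Y H1 H2 : (0 < d)%N ->
  normal_solution X Y H1 H2 ->
  [/\ q%:R = 0 :> F, X *m X = 0 & kernel_condition X H1 H2].
Proof.
move=> d_gt0 NS.
pose z (b g cb cg dl e : 'cV[F]_d) (s : source) := match s with
  | Beta => b | Gamma => g | Cb => cb | Cg => cg | Delta => dl | Z _ => e end.
have XY : X = Y.
  apply/eqP; rewrite -subr_eq0; apply/eqP/mulmx_col_eq0 => v.
  (* [Eb], [Eg], [BG] and [CCD] all cancel here, so the message [(Y - X) v] at [Delta] is zero. *)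
  have := NS TE Delta isT (z (- v) v (X *m v) (- (Y *m v)) (Y *m v - X *m v) 0).
  rewrite /= => NSv; rewrite mulmxBl -[LHS]opprB NSv ?oppr0 //.
  case=> //= _; rewrite ?big_source /= ?big1 // ?mulmxN ?addrN ?addNr ?addr0 //.
  by rewrite add0r subrKA subrr.
split.
- pose o : 'cV[F]_d := const_mx 1.
  have /matrixP/(_ (Ordinal d_gt0) 0) : q%:R *: o = 0.
    (* With e = o and every z_i = -o, each [U i] cancels, and [VQ] cancels because b = q o. *)
    apply: (NS TQ Beta isT (z (q%:R *: o) 0 0 0 o (- o))) => //.
    case=> [|i||||||||] //= _; rewrite big_source /=.
      by rewrite (big_pred1 i) // !add0r subrr.
    by rewrite sumr_const card_ord scaler_nat mulNrn !addr0 subrr.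
  by rewrite !mxE mulr1.
- rewrite -XY in NS; apply: mulmx_col_eq0 => v; rewrite -mulmxA.
  apply/eqP; rewrite -oppr_eq0; apply/eqP.
  (* [Eg] cancels at g = v, [BC] at b = X v, and [Eb] at c = -X X v. *)
  apply: (NS TX Cb isT (z (X *m v) v (- (X *m (X *m v))) (- (X *m v)) 0 0)) => //.
  case=> //= _; rewrite ?addNr // big_source /= big1 // !addr0.
  by rewrite addrC addNr.
- rewrite -XY in NS => b g mb Xb Xg Hbg.
  (* The value of e for which [VM], that is [b - m e], vanishes: by cancellation if m is nonzero,
     and otherwise because b = 0. *)
  pose dl := m%:R^-1 *: b.
  have ker s : dem TA s -> z b g 0 0 dl (- dl) s = 0.
    move=> /(NS TA); apply; first by case.
    case=> [|i||||||||] //= _; rewrite ?Xb ?Xg ?add0r //.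
      by rewrite big_source /= (big_pred1 i) // !add0r subrr.
    rewrite big_source /= (big_ord_narrow le_mq) sumr_const card_ord !addr0.
    rewrite mulNrn -scaler_nat scalerA.
    have [/eqP/mb->|/divff->] := boolP (m%:R == 0 :> F).
      by rewrite scaler0 subrr.
    by rewrite scale1r subrr.
  by split; [exact: (ker Beta) | exact: (ker Gamma)].
Qed.

(** The forms [U], [Eb] and [Eg] give z_i = -e, c = -X b and c' = -X g. Then [VQ] reads b = q e = 0;
    [BC] reads b = X g, so c = -X X g = 0; [BG] and [CCD] give e = X (b + g) = 0. *)
Lemma normal_solution_sufficient X H1 H2 :
  q%:R = 0 :> F -> X *m X = 0 -> kernel_condition X H1 H2 ->
  normal_solution X X H1 H2.
Proof.
move=> q0 XX HK t s ts z zs zr.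
have VU i : accr t (U i) -> z (Z i) = - z Delta.
  move=> /zr /=; rewrite big_source /= (big_pred1 i) // !add0r.
  by move/eqP; rewrite addrC addr_eq0 => /eqP.
have VEb : accr t Eb -> z Cb = - (X *m z Beta).
  by move=> /zr /eqP; rewrite addr_eq0 => /eqP.
have VEg : accr t Eg -> z Cg = - (X *m z Gamma).
  by move=> /zr /eqP; rewrite addr_eq0 => /eqP.
case: t ts zs zr VU VEb VEg => [f s0|||||| ] /=.
- case/and3P=> /eqP-> {s} ff fs zs zr _ _ _.
  have f0 : \sum_(j | inp f j) z j = 0.
    by have := zr f; case: f ff {fs zs zr} => //= *; auto.
  have := zr All isT; rewrite /= (bigID (inp f)) /= f0 add0r (bigD1 s0) //= big1 ?addr0 //.
- case: s => // _ zs _ _ VEb _.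
  by rewrite VEb // zs // mulmx0 oppr0.
- case: s => // _ zs _ _ _ VEg.
  by rewrite VEg // zs // mulmx0 oppr0.
- case: s => // _ _ zr VU _ _; have := zr VQ isT.
  rewrite /= big_source /= (eq_bigr (fun=> - z Delta)) => [|i _]; last exact: VU.
  by rewrite sumr_const card_ord -scaler_nat q0 scale0r !addr0.
- case: s => // _ _ zr _ VEb VEg; have := zr BC isT.
  rewrite /= big_source /= big1 // !addr0 VEg // VEb // => /eqP.
  by rewrite subr_eq0 => /eqP ->; rewrite mulmxA XX mul0mx oppr0.
- case: s => // _ _ zr _ VEb VEg; have := zr BG isT; have := zr CCD isT.
  rewrite /= !big_source /= !big1 // !addr0 !add0r VEg // VEb // => + bg.
  by rewrite -opprD -mulmxDr bg mulmx0 oppr0 add0r.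
move=> ts zs zr VU VEb VEg.
have [] : z Beta = 0 /\ z Gamma = 0; last by case: s ts.
have Cb0 := zs Cb isT; have Cg0 := zs Cg isT.
apply: HK (zr Eh isT).
- move=> m0; have := zr VM isT; rewrite /= big_source /= (big_ord_narrow le_mq).
  rewrite (eq_bigr (fun=> - z Delta)) => [|i _]; last exact: VU.
  by rewrite sumr_const card_ord -scaler_nat m0 scale0r !addr0.
- by apply/eqP; rewrite -oppr_eq0 -VEb // Cb0.
- by apply/eqP; rewrite -oppr_eq0 -VEg // Cg0.
Qed.

Lemma solutionP : (0 < d)%N ->
  layered_solution inp accs accr dem d F <->
  q%:R = 0 :> F /\ exists X H1 H2, X *m X = 0 /\ kernel_condition X H1 H2.
Proof.
move=> d_gt0; split.
  case/solution_normal=> X [Y [H1 [H2 /(normal_solution_necessary d_gt0)[q0 XX HK]]]].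
  by split=> //; exists X, H1, H2.
case=> q0 [X [H1 [H2 [XX HK]]]]; apply: normal_solution_realizable.
exact: normal_solution_sufficient q0 XX HK.
Qed.
End Gadget.

(** * The kernel condition in dimensions 2 and 3 *)

Lemma kernel_condition_dim2 m (F : fieldType) :
  exists X H1 H2 : 'M[F]_2, X *m X = 0 /\ kernel_condition m X H1 H2.
Proof.
(* The Jordan block [X] reveals the second coordinates of b and g; the third function carries their
   first coordinates side by side. *)
exists (delta_mx 0 1), (delta_mx 0 0), (delta_mx 1 0).
split; first by rewrite mul_delta_mx_0.
move=> b g _ /colP Xb /colP Xg /colP H.
have := (H 0, H 1, Xb 0, Xg 0).
rewrite !mxE !big_ord_recl !big_ord0 !mxE /= !(mul1r, mul0r, addr0, add0r).
move=> [[[b0 g0] b1] g1].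
split; apply/colP=> i; rewrite mxE; case: i => [[|[|//]] lt_i].
- by rewrite -[RHS]b0; congr (b _ _); apply: val_inj.
- by rewrite -[RHS]b1; congr (b _ _); apply: val_inj.
- by rewrite -[RHS]g0; congr (g _ _); apply: val_inj.
- by rewrite -[RHS]g1; congr (g _ _); apply: val_inj.
Qed.

Lemma kernel_condition_char m (F : fieldType) d : m%:R = 0 :> F ->
  exists X H1 H2 : 'M[F]_d, X *m X = 0 /\ kernel_condition m X H1 H2.
Proof.
(* As b is already known to vanish, the function of (b, g) can be g itself. *)
move=> m0; exists 0, 0, 1%:M; split; first by rewrite mul0mx.
by move=> b g /(_ m0)-> _ _; rewrite mulmx0 add0r mul1mx.
Qed.

(** The map from (b, g) to (X b, X g, H1 b + H2 g) is injective, so its rank 2d is at most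
    [\rank X + \rank X + d]. *)
Lemma kernel_condition_rank m (F : fieldType) d (X H1 H2 : 'M[F]_d) :
  m%:R != 0 :> F -> kernel_condition m X H1 H2 -> (d <= \rank X + \rank X)%N.
Proof.
move=> m0 HK.
(* The transpose of that map, so that injectivity becomes [row_free]. *)
pose P : 'M_(d + d, (d + d) + d) :=
  row_mx (block_mx X^T 0 0 X^T) (col_mx H1^T H2^T).
have P_free : row_free P.
  rewrite -kermx_eq0; apply/rowV0P => u /sub_kermxP.
  rewrite -(hsubmxK u); set b := lsubmx u; set g := rsubmx u.
  rewrite mul_mx_row mul_row_block mul_row_col !mulmx0 addr0 add0r.
  move=> bgP; have bg := congr1 rsubmx bgP; rewrite row_mxKr linear0 in bg.
  have XX0 := congr1 lsubmx bgP; rewrite row_mxKl linear0 in XX0.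
  have bX := congr1 lsubmx XX0; rewrite row_mxKl linear0 in bX.
  have gX := congr1 rsubmx XX0; rewrite row_mxKr linear0 in gX.
  have [||||/(congr1 trmx) b0 /(congr1 trmx) g0] := HK b^T g^T.
  - by move/eqP; rewrite (negPf m0).
  - by rewrite -[X]trmxK -trmx_mul bX trmx0.
  - by rewrite -[X]trmxK -trmx_mul gX trmx0.
  - by apply: trmx_inj; rewrite linearD /= !trmx_mul !trmxK trmx0.
  by move: b0 g0; rewrite !trmxK !trmx0 => -> ->; rewrite row_mx0.
have rP : (\rank P <= \rank X + \rank X + d)%N.
  rewrite -(mxrank_tr P) tr_row_mx -addsmxE.
  apply: leq_trans (mxrank_adds_leqif _ _).1 _.
  rewrite mxrank_tr rank_diag_block_mx !mxrank_tr leq_add2l.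
  by rewrite -mxrank_tr tr_col_mx !trmxK; apply: rank_leq_row.
by move: rP; rewrite (eqP P_free) leq_add2r.
Qed.

(** [X *m X = 0] bounds twice the rank of [X] by 3 from above. If m were nonzero, the rank bound
    would make it equal to 3, against parity. *)
Lemma kernel_condition_dim3 m (F : fieldType) (X H1 H2 : 'M[F]_3) :
  X *m X = 0 -> kernel_condition m X H1 H2 -> m%:R = 0 :> F.
Proof.
move=> XX HK; apply/eqP; apply: contraT => m0.
have := mulmx0_rank_max XX; have := kernel_condition_rank m0 HK.
rewrite addnn => ge3 le3; have /eqP/(congr1 odd) : (\rank X).*2 == 3.
  by rewrite eqn_leq le3.
by rewrite odd_double.
Qed.

(** * From characteristics to prime factors, and the theorem *)

(** In characteristic p a natural number vanishes iff p divides it, and a prime dividing a product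
    of primes is one of them. *)
Lemma prod_primes_eq0 (F : finFieldType) (P : seq nat) : all prime P ->
  (\prod_(p <- P) p)%N%:R = 0 :> F <-> exists2 p, p \in [pchar F] & p \in P.
Proof.
move=> prP; split=> [P0|[p pF pP]].
  have [p p_pr pF] := finPcharP F; exists p => //.
  have: (p %| \prod_(p <- P) p)%N by rewrite (dvdn_pcharf pF) P0.
  elim: P prP {P0} => [|r P IH] /=.
    by rewrite big_nil dvdn1 => _ /eqP p1; rewrite p1 in p_pr.
  case/andP=> r_pr /IH{}IH; rewrite big_cons Euclid_dvdM // inE dvdn_prime2 //.
  by case/orP=> [->//|/IH->]; rewrite orbT.
by apply/eqP; rewrite -(dvdn_pcharf pF) (big_rem p) //= dvdn_mulr.
Qed.

Theorem theorem4 (P1 P2 : seq nat) :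
  P1 != [::] -> P2 != [::] -> all prime P1 -> all prime P2 ->
  exists N : network,
    well_formed N /\ P_eq N 2 (P1 ++ P2) /\ P_eq N 3 P2.
Proof.
move=> _ _ prP1 prP2.
pose q := (\prod_(p <- P1 ++ P2) p)%N; pose m := (\prod_(p <- P2) p)%N.
have q_gt0 : (0 < q)%N.
  rewrite /q big_seq prodn_cond_gt0 // => p.
  by rewrite mem_cat => /orP[/(allP prP1)|/(allP prP2)]/prime_gt0.
(* Divisibility gives [m <= q], so that [VM] can sum the first m of the q sources [Z], and makes q
   vanish wherever m does. *)
have dvd_mq : (m %| q)%N by rewrite /q big_cat dvdn_mull.
have le_mq : (m <= q)%N by apply: dvdn_leq.
have m0q0 (F : fieldType) : m%:R = 0 :> F -> q%:R = 0 :> F.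
  by move=> m0; case/dvdnP: dvd_mq => k ->; rewrite natrM m0 mulr0.
have prP : all prime (P1 ++ P2) by rewrite all_cat prP1.
exists (layered_net (inp m (q := q)) (accs m (q := q)) (accr (q := q)) (dem m (q := q))).
split; first exact: layered_net_wf.
split=> F.
- apply: iff_trans (layered_netP _ _ _ _ _ _) _.
  apply: iff_trans (solutionP le_mq F (isT : (0 < 2)%N)) _.
  apply: iff_trans (prod_primes_eq0 F prP).
  by split=> [[]|q0]; last by split=> //; apply: kernel_condition_dim2.
- apply: iff_trans (layered_netP _ _ _ _ _ _) _.
  apply: iff_trans (solutionP le_mq F (isT : (0 < 3)%N)) _.
  apply: iff_trans (prod_primes_eq0 F prP2).
  split=> [[_ [X [H1 [H2 [XX HK]]]]]|m0]; first exact: kernel_condition_dim3 XX HK.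
  by split; [apply: m0q0 | apply: kernel_condition_char].
Qed.
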